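(* Consider an online inventory optimization problem with $n$ products and feasible set $\mathcal{Y}\subset\mathbb{R}^n_+$, demands $(d_t)_{t\in\mathbb{N}}$ and losses $(\ell_t)_{t\in\mathbb{N}}$ such that: (A) $\mathcal{Y}$ is closed, convex, contained in $\mathbb{R}^n_+$, with $\operatorname{diam}\mathcal{Y}\le D$ for some $D\ge 0$; each $\ell_t$ is convex; and there is $G>0$ such that $\|g\|_2\le G$ for all $t\in\mathbb{N}$, $y\in\mathcal{Y}$, $g\in\partial\ell_t(y)$; (B) there exist $\mu\in(0,1]$ and $\rho>0$ such that for all $t\in\mathbb{N}$, almost surely, $$\mathbb{P}\left[\forall i\in\{1,\dots,n\},\ d_{t,i}\ge\rho \,\middle|\, \ell_1,d_1,\dots,\ell_{t-1},d_{t-1}\right]\ge\mu;$$ (C) the dynamics and the subgradient selection are deterministic (as defined in the context). Then MaxCOSD (defined in the context) run with any $y_1\in\mathcal{Y}$ and any $\gamma>0$ is feasible, i.e. $y_t\succeq x_t$ for all $t\in\mathbb{N}$. Furthermore, when $\gamma\in(0,\rho/D]$, for all $T\in\mathbb{N}$, $$\mathbb{E}[R_T]\le\frac{\sqrt{2}\,GD}{\mu}\left(\frac{1}{2\gamma}+\gamma+1\right)\sqrt{T},$$ and for any $\delta\in(0,1)$, with probability at least $1-\delta$, $$R_T\le GD\left(\frac{1}{2\gamma}+\gamma+1\right)\left(1+\frac{1}{\mu}\log\left(\frac{T}{\delta}\right)\right)\sqrt{T}.$$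
   Context: Conventions: $\mathbb{N}=\{1,2,\dots\}$; $\mathbb{R}_+=[0,\infty)$; $\preceq,\succeq$ are componentwise inequalities in $\mathbb{R}^n$; $[v]^+$ is the componentwise positive part; $\operatorname{Proj}_{\mathcal{Y}}$ is Euclidean projection; $\operatorname{diam}$ is the Euclidean diameter; $\partial\ell$ is the convex subdifferential; measurability of all maps and quantities involved is tacitly assumed. If $D=0$, $\rho/D$ is read as $+\infty$ (the interval is $(0,\infty)$). Online inventory optimization (OIO) problem (also called inventory problem). The environment sets $x_1=\mathbf{0}\in\mathbb{R}^n$ and chooses in advance (possibly random) demands $d_t\in\mathbb{R}^n_+$ and losses $\ell_t:\mathbb{R}^n\to\mathbb{R}$ for all $t\in\mathbb{N}$ (their distribution is fixed in advance; no independence or stationarity is assumed). For each $t\in\mathbb{N}$: (i) the manager observes the inventory state $x_t\in\mathbb{R}^n$; (ii) the manager chooses $y_t\in\mathcal{Y}$, which must satisfy the feasibility constraint $y_t\succeq x_t$; (iii) the manager suffers $\ell_t(y_t)$ and observes a subgradient $g_t\in\partial\ell_t(y_t)$; (iv) the environment chooses $x_{t+1}\in\mathbb{R}^n$ satisfying $x_{t+1}\preceq[y_t-d_t]^+$. An algorithm is feasible if $y_t\succeq x_t$ for all $t$. Regret: $R_T=\sum_{t=1}^T\ell_t(y_t)-\inf_{y\in\mathcal{Y}}\sum_{t=1}^T\ell_t(y)$. Deterministic dynamics: for all $t$, $x_{t+1}=X_t(y_1,d_1,\dots,y_t,d_t)$ where $X_t:(\mathcal{Y}\times\mathbb{R}^n_+)^t\to\mathbb{R}^n$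 is a fixed-in-advance function with $X_t(y'_1,d'_1,\dots,y'_t,d'_t)\preceq[y'_t-d'_t]^+$ for all possible realizations. Deterministic subgradient selection: for all $t$, $g_t=\Gamma_t(\ell_t,y_t)$ where $\Gamma_t$ is a fixed-in-advance function with $\Gamma_t(\ell'_t,y'_t)\in\partial\ell'_t(y'_t)$ for all possible realizations. MaxCOSD with parameters $\gamma>0$ and $y_1\in\mathcal{Y}$. Initialize $\hat y_1=y_1$, $t_1=1$, $k=1$. For $t=1,2,\dots$: output $y_t$; observe $g_t\in\partial\ell_t(y_t)$ and $x_{t+1}$; compute $$\hat y_{t+1}=\operatorname{Proj}_{\mathcal{Y}}\left(\hat y_{t_k}-\eta_t\sum_{s=t_k}^t g_s\right),\qquad \eta_t=\frac{\gamma D}{\sqrt{\left\|\sum_{s=t_k}^t g_s\right\|_2^2+\sum_{m=1}^{k-1}\left\|\sum_{s\in\mathcal{T}_m}g_s\right\|_2^2}},$$ where $k$ is the current value of the counter, $\mathcal{T}_m=\{t_m,\dots,t_{m+1}-1\}$, and $\eta_t=0$ if the denominator is zero. If $x_{t+1}\preceq\hat y_{t+1}$, set $y_{t+1}=\hat y_{t+1}$, $t_{k+1}=t+1$, and then $k\leftarrow k+1$; otherwise set $y_{t+1}=y_t$. *)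

(* Defs.v *)
From HB Require Import structures.
From mathcomp Require Import all_boot all_order all_algebra.
From mathcomp Require Import all_classical all_reals all_analysis.

Set Implicit Arguments.
Unset Strict Implicit.
Unset Printing Implicit Defensive.

Import Order.TTheory GRing.Theory Num.Theory.
Import numFieldNormedType.Exports.

Local Open Scope classical_set_scope.
Local Open Scope ring_scope.

(* Rounds and cycles are numbered from 0: index t below is round t + 1 of the
   protocol, and index m is cycle m + 1. *)

Section euclidean.
Context {R : realType} {n : nat}.
Implicit Types (u v y z : 'rV[R]_n) (Y : set 'rV[R]_n) (f : 'rV[R]_n -> R).

Definition edot u v : R := \sum_(i < n) u 0 i * v 0 i.

(* The library norm on 'rV[R]_n is the sup norm, hence a separate notion. *)
Definition enorm u : R := Num.sqrt (edot u u).

Definition ediam Y : \bar R :=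
  ereal_sup [set (enorm (u - v))%:E | u in Y & v in Y].

Definition lev u v : bool := [forall i, u 0 i <= v 0 i].

Definition posv u : 'rV[R]_n := \row_i Num.max (u 0 i) 0.

(* Default value 0 when no nearest point exists; for Y nonempty, closed and
   convex the nearest point exists and is unique. *)
Definition eproj Y z : 'rV[R]_n :=
  xget 0 [set p | Y p /\ forall q, Y q -> enorm (z - p) <= enorm (z - q)].

Definition subdiff f y : set 'rV[R]_n :=
  [set g | forall z, f y + edot g (z - y) <= f z].

End euclidean.

Section inventory.
Context {R : realType} {n : nat}.
Implicit Types (Y : set 'rV[R]_n) (d g x y : nat -> 'rV[R]_n)
  (ell : nat -> 'rV[R]_n -> R).

Definition regret Y ell y (T : nat) : R :=
  \sum_(t < T) ell t (y t) - inf [set \sum_(t < T) ell t u | u in Y].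

(* The restriction of X to sequences of length t + 1 is the map that sends
   (y_0, d_0, ..., y_t, d_t) to the next inventory state. *)
Definition dynamics_rule Y (X : seq ('rV[R]_n * 'rV[R]_n) -> 'rV[R]_n) :=
  forall (h : seq ('rV[R]_n * 'rV[R]_n)) (y' d' : 'rV[R]_n),
    (forall z, z \in rcons h (y', d') -> Y z.1 /\ lev 0 z.2) ->
    lev (X (rcons h (y', d'))) (posv (y' - d')).

Definition follows_dynamics (X : seq ('rV[R]_n * 'rV[R]_n) -> 'rV[R]_n) d x y :=
  x 0%N = 0 /\ forall t, x t.+1 = X (mkseq (fun s => (y s, d s)) t.+1).

Definition maxcosd_eta (gamma D : R) g (tau : nat -> nat) (k t : nat) : R :=
  let den := Num.sqrt
    (enorm (\sum_(tau k <= s < t.+1) g s) ^+ 2 +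
     \sum_(m < k) enorm (\sum_(tau m <= s < tau m.+1) g s) ^+ 2) in
  if den == 0 then 0 else gamma * D / den.

(* y is the output of MaxCOSD on the feedback g, x.  Here k t is the index of
   the cycle to which round t belongs and tau m is the first round of cycle m. *)
Definition maxcosd Y (D gamma : R) (y1 : 'rV[R]_n) g x y : Prop :=
  exists (yhat : nat -> 'rV[R]_n) (k tau : nat -> nat),
  [/\ y 0%N = y1, yhat 0%N = y1, k 0%N = 0%N, tau 0%N = 0%N &
   forall t,
    yhat t.+1 = eproj Y (yhat (tau (k t)) -
        maxcosd_eta gamma D g tau (k t) t *: \sum_(tau (k t) <= s < t.+1) g s)
    /\ if lev (x t.+1) (yhat t.+1)
       then [/\ y t.+1 = yhat t.+1, k t.+1 = (k t).+1 & tau (k t.+1) = t.+1]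
       else y t.+1 = y t /\ k t.+1 = k t].

End inventory.

Section probability.
Context {R : realType} {disp : measure_display} {Omega : measurableType disp}
  (P : probability Omega R).

(* Z is a version of the conditional probability of E given the
   sigma-algebra F. *)
Definition is_cond_prob (F : set (set Omega)) (E : set Omega) (Z : Omega -> R) :=
  [/\ forall B : set R, measurable B -> F (Z @^-1` B),
      P.-integrable setT (EFin \o Z) &
      forall A, F A -> (\int[P]_(w in A) (Z w)%:E)%E = P (E `&` A)].

(* The sigma-algebra generated by the losses and demands of the rounds before
   t; a random loss is a random element of the space of functions with the
   product (evaluation) sigma-algebra. *)
Definition past {n : nat} (ell : nat -> Omega -> 'rV[R]_n -> R)
    (d : nat -> Omega -> 'rV[R]_n) (t : nat) : set (set Omega) :=
  <<s \bigcup_(s in [set s | (s < t)%N])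
        ((\bigcup_z preimage_set_system setT (fun w => ell s w z) measurable) `|`
         (\bigcup_i preimage_set_system setT (fun w => d s w 0 i) measurable)) >>.

End probability.

(* Main.v *)
(* Whenever all demands are at least rho, the state falls by at least rho in
   every positive coordinate while the candidate iterate moves by at most
   gamma D <= rho, so the current cycle closes.  Cycles are therefore no longer
   than the gaps between such rounds, and a gap persists with probability at
   most 1 - mu per round.  On cycles MaxCOSD is projected online gradient descent
   with AdaGrad-norm steps, so its regret is at most
   D (1/(2 gamma) + gamma) times the root of the sum of the squared norms of the
   cycle gradients, and this sum is at most G^2 times the sum over t of
   2 a_t - 1, where a_t is the age of the current gap: L^2 is the sum of the first
   L odd numbers.  The a_t are functions of the past demands, so (B)
   controls their law even though the iterates need not be measurable. *)
Require Import Defs.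
From HB Require Import structures.
From mathcomp Require Import all_boot all_order all_algebra.
From mathcomp Require Import ring lra.
From mathcomp Require Import all_classical all_reals all_analysis.
From mathcomp Require Import measurable_realfun.

Set Implicit Arguments.
Unset Strict Implicit.
Unset Printing Implicit Defensive.

Import Order.TTheory GRing.Theory Num.Theory.
Import numFieldNormedType.Exports.

Local Open Scope classical_set_scope.
Local Open Scope ring_scope.

(** * Euclidean projection *)

Section euclidean.
Context {R : realType} {n : nat}.
Implicit Types (u v w z p q : 'rV[R]_n) (Y : set 'rV[R]_n) (a b c : R).

Lemma edotC u v : edot u v = edot v u.
Proof. by apply: eq_bigr => i _; rewrite mulrC. Qed.

Lemma edotDl u v w : edot (u + v) w = edot u w + edot v w.
Proof. by rewrite -big_split; apply: eq_bigr => i _; rewrite mxE mulrDl. Qed.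

Lemma edotZl a u v : edot (a *: u) v = a * edot u v.
Proof. by rewrite /edot mulr_sumr; apply: eq_bigr => i _; rewrite mxE mulrA. Qed.

Lemma edotNl u v : edot (- u) v = - edot u v.
Proof. by rewrite -scaleN1r edotZl mulN1r. Qed.

Lemma edotDr u v w : edot w (u + v) = edot w u + edot w v.
Proof. by rewrite edotC edotDl !(edotC w). Qed.

Lemma edotZr a u v : edot v (a *: u) = a * edot v u.
Proof. by rewrite edotC edotZl edotC. Qed.

Lemma edotNr u v : edot v (- u) = - edot v u.
Proof. by rewrite edotC edotNl edotC. Qed.

Lemma edot0l u : edot 0 u = 0.
Proof. by rewrite -(scale0r u) edotZl mul0r. Qed.

Definition edotE := (edotDl, edotDr, edotNl, edotNr, edotZl, edotZr).

Lemma edot_ge0 u : 0 <= edot u u.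
Proof. by apply: sumr_ge0 => i _; rewrite -expr2 sqr_ge0. Qed.

Lemma edot_eq0 u : edot u u = 0 -> u = 0.
Proof.
move=> /eqP; rewrite psumr_eq0 => [/allP u0|i _]; last by rewrite -expr2 sqr_ge0.
apply/rowP => i; have := u0 i (mem_index_enum _).
by rewrite -expr2 sqrf_eq0 mxE => /eqP.
Qed.

Lemma sqr_coord_le_edot u i : u 0 i ^+ 2 <= edot u u.
Proof.
rewrite /edot (bigD1 i)//= -expr2 lerDl.
by apply: sumr_ge0 => j _; rewrite -expr2 sqr_ge0.
Qed.

Lemma sqr_enorm u : enorm u ^+ 2 = edot u u.
Proof. by rewrite sqr_sqrtr ?edot_ge0. Qed.

Lemma enorm_ge0 u : 0 <= enorm u. Proof. exact: sqrtr_ge0. Qed.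

Lemma enorm_le u v : (enorm u <= enorm v) = (edot u u <= edot v v).
Proof. by rewrite ler_sqrt ?edot_ge0. Qed.

Lemma enorm_lec u c : 0 <= c -> (enorm u <= c) = (edot u u <= c ^+ 2).
Proof. by move=> c0; rewrite -sqr_enorm ler_sqr ?nnegrE ?enorm_ge0. Qed.

Lemma coord_le_enorm u i : `|u 0 i| <= enorm u.
Proof. by rewrite -sqrtr_sqr ler_sqrt ?edot_ge0// sqr_coord_le_edot. Qed.

(** Induction on the number of summands: [2 l <u, v> <= |u|^2 + l^2 |v|^2] bounds [|u + v|^2] by [(1
    + 1/l) (G l)^2 + (1 + l) G^2 = (G (l + 1))^2]. The weight [1/l] forces the separate case
    [l = 0]. *)
Lemma edot_sum_le (g : nat -> 'rV[R]_n) G (i l : nat) :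
  (forall s, enorm (g s) <= G) ->
  edot (\sum_(i <= s < i + l) g s) (\sum_(i <= s < i + l) g s)
    <= (G * l%:R) ^+ 2.
Proof.
move=> gG; have G0 : 0 <= G by rewrite (le_trans (enorm_ge0 (g 0%N))).
elim: l => [|l ih]; first by rewrite addn0 big_geq// edot0l sqr_ge0.
rewrite addnS big_nat_recr ?leq_addr//=.
have := gG (i + l)%N; rewrite enorm_lec//.
move: (g _) ih => v; move: (\sum_(_ <= _ < _) _) => u uG vG.
have [l0|l0] := eqVneq l 0%N.
  have /edot_eq0 -> : edot u u = 0.
    by apply/le_anti; rewrite edot_ge0 (le_trans uG)// l0 mulr0 expr0n.
  by rewrite add0r l0 mulr1.
have lp : 0 < l%:R :> R by rewrite ltr0n lt0n.
have := edot_ge0 (u - l%:R *: v); rewrite !edotE (edotC v u) -[l.+1%:R]natr1.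
nra.
Qed.

Lemma edot_diam_le Y D u v : 0 <= D -> (ediam Y <= D%:E)%E -> Y u -> Y v ->
  edot (u - v) (u - v) <= D ^+ 2.
Proof.
move=> D0 YD Yu Yv; rewrite -enorm_lec// -lee_fin (le_trans _ YD)//.
by apply: ereal_sup_ubound; exists u => //; exists v.
Qed.

(** A finite diameter puts the closed set [Y] in a box, so [Y] is compact and the squared distance
    attains its minimum; [eproj] then never falls back on its default value. *)
Lemma eproj_exists Y D z : closed Y -> Y !=set0 -> 0 <= D ->
  (ediam Y <= D%:E)%E ->
  [set p | Y p /\ forall q, Y q -> enorm (z - p) <= enorm (z - q)] (eproj Y z).
Proof.
move=> Ycl Y0 D0 YD; have [u Yu] := Y0.
have Yco : compact Y.
  apply: (@subclosed_compact _ Y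
    [set v : 'rV[R]_n | forall i, `[u 0 i - D, u 0 i + D]%classic (v ord0 i)]).
  - exact: Ycl.
  - apply: (@rV_compact R n (fun i => `[u 0 i - D, u 0 i + D]%classic)) => i.
    exact: segment_compact.
  - move=> v Yv i /=; rewrite in_itv/=.
    have := le_trans (coord_le_enorm (v - u) i) _.
    move/(_ D); rewrite enorm_lec// (edot_diam_le D0 YD)// => /(_ isT).
    by rewrite !mxE ler_norml; lra.
have zc : continuous (fun p : 'rV[R]_n => edot (z - p) (z - p)).
  rewrite /edot; elim: (index_enum _) => [|i r ih].
    by under eq_fun do rewrite big_nil; exact: cst_continuous.
  under eq_fun do rewrite big_cons.
  have c : continuous (fun p : 'rV[R]_n => (z - p) 0 i).
    rewrite (_ : (fun p => _) = fun p : 'rV[R]_n => z 0 i - p 0 i); last first.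
      by apply/funext => p; rewrite !mxE.
    by move=> p; apply: continuousB; [exact: cst_continuous|exact: coord_continuous].
  by move=> p; exact: (continuousD (continuousM (c p) (c p)) (ih p)).
have [p pY pmin] := EVT_min_rV Y0 Yco (continuous_subspaceT zc).
apply: (@xgetPex _ 0); exists p; split; first by rewrite inE in pY.
by move=> q Yq; rewrite enorm_le; apply: pmin; rewrite inE.
Qed.

Lemma nearest_obtuse Y z p q : @convex_set R 'rV[R]_n Y -> Y p -> Y q ->
  (forall r, Y r -> enorm (z - p) <= enorm (z - r)) -> edot (z - p) (q - p) <= 0.
Proof.
move=> Yc Yp Yq pmin; rewrite leNgt; apply/negP => a0.
set a := edot _ _ in a0; pose b := edot (q - p) (q - p).
have b0 : 0 <= b := edot_ge0 _.
have ab0 : 0 < a + b by rewrite ltr_wpDr.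
(* Moving from [p] towards [q] by a fraction [l] changes the squared distance to [z] by
   [l (l b - 2 a)]. The choice [l = a / (a + b)] lies in [[0, 1]] even if [b = 0], and gives
   [l b <= a < 2 a], against minimality. *)
have lP : 0 <= a / (a + b) <= 1.
  by rewrite divr_ge0 ?(ltW a0) ?(ltW ab0)//= ler_pdivrMr// mul1r lerDl.
pose l : {i01 R} := Itv01 (andP lP).1 (andP lP).2.
have /pmin : Y (l%:num *: q + (1 - l%:num) *: p).
  have := Yc q p l; rewrite !inE => /(_ Yq Yp); exact.
have -> : z - (l%:num *: q + (1 - l%:num) *: p) = (z - p) - l%:num *: (q - p).
  by apply/rowP => i; rewrite !mxE; ring.
rewrite enorm_le; move: (z - p) (q - p) @a @b a0 b0 ab0 lP @l => c e /=.
set a := edot c e; set b := edot e e => a0 b0 ab0 lP.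
rewrite !edotE -/b (edotC e c) -/a => H.
have le : a / (a + b) * (a + b) = a by rewrite divfK// gt_eqF.
have : 0 < a / (a + b) by rewrite divr_gt0.
move: (a / (a + b)) le H lP => l le H lP l0.
have {}H : l * (2 * a) <= l * (l * b) by lra.
by move: H; rewrite ler_pM2l//; nra.
Qed.

(** Expand [|z - q|^2 = |z - p|^2 - 2 <z - p, q - p> + |p - q|^2]; the angle at [p] is obtuse. *)
Lemma edot_nearest_le Y z p q : @convex_set R 'rV[R]_n Y -> Y p -> Y q ->
  (forall r, Y r -> enorm (z - p) <= enorm (z - r)) ->
  edot (p - q) (p - q) <= edot (z - q) (z - q).
Proof.
move=> Yc Yp Yq pmin; have := nearest_obtuse Yc Yp Yq pmin.
have -> : z - q = (z - p) - (q - p) by rewrite opprB addrA subrK.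
have := edot_ge0 (z - p); rewrite !edotE.
rewrite (edotC q p) (edotC q z) (edotC p z); lra.
Qed.

Lemma eproj_in Y D z : closed Y -> Y !=set0 -> 0 <= D ->
  (ediam Y <= D%:E)%E -> Y (eproj Y z).
Proof. by move=> Ycl Y0 D0 YD; have [] := eproj_exists z Ycl Y0 D0 YD. Qed.

Lemma edot_eproj_le Y D z q : closed Y -> @convex_set R 'rV[R]_n Y -> 0 <= D ->
  (ediam Y <= D%:E)%E -> Y q ->
  edot (eproj Y z - q) (eproj Y z - q) <= edot (z - q) (z - q).
Proof.
move=> Ycl Yc D0 YD Yq; have Y0 : Y !=set0 by exists q.
by have [Yp pmin] := eproj_exists z Ycl Y0 D0 YD; exact: (@edot_nearest_le Y).
Qed.

End euclidean.

(** * Time since the last large demand *)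

(** A finite boolean quantifier makes the event a finite intersection, hence measurable, and lets
    [age] be a sum of indicators, whose expectation is a sum of probabilities. *)
Definition quiet (b : nat -> bool) (s t : nat) : bool :=
  [forall r : 'I_t, (s <= r)%N ==> ~~ b r].

(* One plus the number of consecutive rounds just before [t] in which [b] fails. *)
Definition age (b : nat -> bool) (t : nat) : nat :=
  (\sum_(s < t.+1) quiet b s t)%N.

Lemma quietS b s t : (s <= t)%N -> quiet b s t.+1 = quiet b s t && ~~ b t.
Proof.
move=> st; apply/forallP/andP => [q|[/forallP q bt] r].
  split; last by have := q ord_max; rewrite /= st.
  by apply/forallP => r; have := q (widen_ord (leqnSn t) r).
have [rt|] := ltnP r t; first by have := q (Ordinal rt).
by move=> tr; apply/implyP => _; have/eqP -> : r == t :> nat;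
  rewrite // eqn_leq tr -ltnS ltn_ord.
Qed.

Lemma quietnn b t : quiet b t t.
Proof. by apply/forallP => r; rewrite leqNgt ltn_ord. Qed.

Lemma age0 b : age b 0 = 1%N.
Proof. by rewrite /age big_ord_recl big_ord0 quietnn. Qed.

Lemma ageS b t : age b t.+1 = if b t then 1%N else (age b t).+1.
Proof.
rewrite /age big_ord_recr/= quietnn addn1.
under eq_bigr do rewrite quietS -1?ltnS//.
case: (b t); last by under eq_bigr do rewrite andbT.
by under eq_bigr do rewrite andbF; rewrite big1.
Qed.

(** Reduces a large age to a single quiet block of fixed length [j], as a union bound over [t]
    requires. *)
Lemma age_gt b t j : (j < age b t)%N -> (j <= t)%N && quiet b (t - j) t.
Proof.
elim: t j => [|t ih] j; first by rewrite age0 ltnS leqn0 => /eqP ->; rewrite quietnn.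
rewrite ageS; case: ifPn => [bt|bt].
  by rewrite ltnS leqn0 => /eqP ->; rewrite quietnn.
case: j => [|j]; first by rewrite quietnn.
rewrite ltnS => /ih /andP[jt q].
by rewrite ltnS jt subSS quietS ?leq_subr// q.
Qed.

Lemma age_gt0 b t : (0 < age b t)%N.
Proof. by case: t => [|t]; rewrite ?age0// ageS; case: ifP. Qed.

(** * Regret along a single run *)

Section maxcosd_step.
Context {R : realType} {n : nat}.
Implicit Types (h z u : 'rV[R]_n) (c D S a : R).

(* Online gradient descent run over cycles: [S] is the accumulated squared norm
   of the cycle gradients and [a] the squared distance to the comparator. *)
Definition potential c D S a : R := Num.sqrt S * ((D ^+ 2 - a) / (2 * c) + c).

(** This is [maxcosd_eta] with [c] for [gamma * D], [h] for the gradient sum of the current cycle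
    and [S] for the squared norms of the closed cycles. *)
Definition adastep c S h : R :=
  let den := Num.sqrt (edot h h + S) in if den == 0 then 0 else c / den.

(** The norm of [h] is at most the denominator of the step. This caps the displacement before
    projection. *)
Lemma adastep_norm c S h : 0 <= c -> 0 <= S ->
  edot (adastep c S h *: h) (adastep c S h *: h) <= c ^+ 2.
Proof.
move=> c0 S0; rewrite !edotE /adastep; case: eqP => [_|/eqP d0].
  by rewrite mul0r sqr_ge0.
have H0 := edot_ge0 h; have HS0 : 0 <= edot h h + S by rewrite addr_ge0.
rewrite mulrA -expr2 expr_div_n sqr_sqrtr// -mulrA ler_piMr ?sqr_ge0//.
rewrite mulrC ler_pdivrMr ?mul1r ?lerDl//.
by rewrite ltNge -sqrtr_eq0.
Qed.

(** The growth of the potential pays for the linear regret of one cycle: expand the squared distance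
    after the step and multiply by the denominator [r], the root of [H + S], so that the bound
    telescopes over cycles. *)
Lemma potential_step c D S h z z' u : 0 < c -> 0 <= S ->
  edot (z - u) (z - u) <= D ^+ 2 ->
  edot (z' - u) (z' - u) <=
    edot (z - adastep c S h *: h - u) (z - adastep c S h *: h - u) ->
  potential c D S (edot (z - u) (z - u)) + edot h (z - u) <=
  potential c D (edot h h + S) (edot (z' - u) (z' - u)).
Proof.
move=> c0 S0 zuD; rewrite addrAC /potential /adastep /=.
move: (edot (z' - u) (z' - u)) => a'; set e := (if _ then _ else _).
have -> : edot (z - u - e *: h) (z - u - e *: h) =
    edot (z - u) (z - u) - 2 * (e * edot h (z - u)) + e ^+ 2 * edot h h.
  move: (z - u) => v; rewrite !(edotDl, edotDr, edotNl, edotNr, edotZl, edotZr).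
  by rewrite (edotC v h); ring.
have h0 : edot h h = 0 -> edot h (z - u) = 0 by move=> /edot_eq0 ->; rewrite edot0l.
have := edot_ge0 h; move: (edot h h) (edot h (z - u)) (edot (z - u) (z - u)) h0 zuD @e.
move=> H x a h0 aD e H0; rewrite {}/e.
have HS0 : 0 <= H + S by rewrite addr_ge0.
have Sle : Num.sqrt S <= Num.sqrt (H + S) by rewrite ler_wsqrtr// lerDr.
have := sqr_sqrtr S0; have := sqr_sqrtr HS0.
case: eqP => [r0|/eqP r0] rr ss.
  (* A zero denominator means [S = 0] and [h = 0], so both sides vanish. *)
  move=> _; have E : H + S = 0 by rewrite -rr r0 expr0n.
  have -> : S = 0 by lra.
  by rewrite addr0 (_ : H = 0) ?h0 ?sqrtr0 ?mul0r ?addr0//; lra.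
have rp : 0 < Num.sqrt (H + S) by rewrite lt_def r0 sqrtr_ge0.
have := sqrtr_ge0 S; move: (Num.sqrt S) (Num.sqrt (H + S)) Sle rr ss rp {r0}.
move=> s r sr rr ss r0 s0 a'le.
have {a'le} : a' * r <= a * r - 2 * c * x + c ^+ 2 / r * H.
  rewrite -(ler_pM2r r0) in a'le; apply: (le_trans a'le).
  by rewrite le_eqVlt; apply/orP; left; apply/eqP; field; rewrite gt_eqF.
(* Since [H = r^2 - s^2], the quadratic error [H / r] is at most [2 (r - s)], a telescoping
   difference. *)
have -> : c ^+ 2 / r * H = c ^+ 2 * (r - s) * ((r + s) / r).
  have -> : H = (r - s) * (r + s) by lra.
  by ring.
have sr2 : (r + s) / r <= 2 by rewrite ler_pdivrMr//; lra.
have cs : 0 <= c ^+ 2 * (r - s) by rewrite mulr_ge0 ?sqr_ge0 ?subr_ge0.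
have {sr2 cs} := ler_wpM2l cs sr2; move: (_ * (_ / _)) => y y2 a'le.
have {a'le} a'le : s * (D ^+ 2 - a) + 2 * c * x + 2 * c ^+ 2 * s <=
    r * (D ^+ 2 - a') + 2 * c ^+ 2 * r.
  (* The potential weighs [D ^+ 2 - a], which is nonnegative, so its weight may grow from [s] to
     [r]. *)
  have : 0 <= (r - s) * (D ^+ 2 - a) by rewrite mulr_ge0 ?subr_ge0.
  lra.
have c2 : 0 < 2 * c by rewrite mulr_gt0.
rewrite -(ler_pM2l c2); apply: le_trans (le_trans a'le _); rewrite le_eqVlt;
by apply/orP; left; apply/eqP; field; rewrite gt_eqF.
Qed.

End maxcosd_step.

Section maxcosd_run.
Context {R : realType} {n : nat} (Y : set 'rV[R]_n) (D gamma G rho : R)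
  (y1 : 'rV[R]_n) (d g x y : nat -> 'rV[R]_n).
Context (Y_closed : closed Y) (Y_convex : @convex_set R 'rV[R]_n Y)
  (Y_ge0 : forall u, Y u -> lev 0 u) (D_ge0 : 0 <= D)
  (Y_diam : (ediam Y <= D%:E)%E) (y1_in : Y y1) (gamma_gt0 : 0 < gamma)
  (run : maxcosd Y D gamma y1 g x y).

Let Y_neq0 : Y !=set0. Proof. by exists y1. Qed.

Lemma maxcosd_in t : Y (y t).
Proof.
have [yhat [k [tau [y0 _ _ _ step]]]] := run.
elim: t => [|t ih]; first by rewrite y0.
have [yE] := step t; case: ifP => _ [->] // _ _.
by rewrite yE; exact: (eproj_in _ Y_closed Y_neq0 D_ge0 Y_diam).
Qed.

Context (d_ge0 : forall t, lev 0 (d t)) (x0 : x 0%N = 0)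
  (x_le : forall t, lev (x t.+1) (posv (y t - d t))).

(** An accepted candidate has passed the test; otherwise [y] is repeated, and it dominates the
    positive part of [y t - d t] because [y t] and [d t] are nonnegative. *)
Lemma maxcosd_feasible t : lev (x t) (y t).
Proof.
case: t => [|t]; first by rewrite x0; exact/Y_ge0/maxcosd_in.
have [yhat [k [tau [_ _ _ _ step]]]] := run.
have [_] := step t; case: ifP => [le [-> _ _] //|_ [-> _]].
apply/forallP => i; have /forallP/(_ i)/le_trans := x_le t; apply.
have /forallP/(_ i) := d_ge0 t; have /forallP/(_ i) := Y_ge0 (maxcosd_in t).
by rewrite !mxE => y0 dt0; rewrite ge_max y0 andbT lerBlDr lerDl.
Qed.

Context (G_gt0 : 0 < G) (g_le : forall t, enorm (g t) <= G)
  (gammaD_le : gamma * D <= rho).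

Let big_demand t := [forall i, rho <= d t 0 i].

(** No coordinate of the projected step falls more than [rho] below [z], while every coordinate of
    [z - d t] does fall by [rho]; nonnegativity of the projection covers the emptied coordinates. *)
Lemma proj_step_closes z h S t : Y z -> y t = z -> 0 <= S -> big_demand t ->
  lev (x t.+1) (eproj Y (z - adastep (gamma * D) S h *: h)).
Proof.
move=> Yz yz S0 /forallP dt; set p := eproj _ _; apply/forallP => i.
have gD0 : 0 <= gamma * D by rewrite mulr_ge0// ltW.
have pz : edot (p - z) (p - z) <= (gamma * D) ^+ 2.
  apply: le_trans (edot_eproj_le _ Y_closed Y_convex D_ge0 Y_diam Yz) _.
  by rewrite addrAC subrr add0r edotNl edotNr opprK adastep_norm.
move: pz; rewrite -enorm_lec// => /(le_trans (coord_le_enorm _ i)).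
move=> /le_trans/(_ gammaD_le); rewrite !mxE ler_norml => /andP[pz _].
have Yp : Y p by exact: (eproj_in _ Y_closed Y_neq0 D_ge0 Y_diam).
have /forallP/(_ i) := Y_ge0 Yp; rewrite mxE => p0.
have /forallP/(_ i)/le_trans := x_le t; apply; rewrite yz !mxE ge_max p0 andbT.
have := dt i; lra.
Qed.

Lemma maxcosd_linear_regret u T : 0 < D -> Y u ->
  \sum_(s < T) edot (g s) (y s - u) <=
  G * D * ((2 * gamma)^-1 + gamma) *
    Num.sqrt (\sum_(s < T) (2 * (age big_demand s)%:R - 1)).
Proof.
move=> D_gt0 Yu; have [yhat [k [tau [y0 yh0 k0 tau0 step]]]] := run.
pose S m := \sum_(j < m) enorm (\sum_(tau j <= s < tau j.+1) g s) ^+ 2.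
pose H t := \sum_(tau (k t) <= s < t.+1) g s.
pose A t := \sum_(s < t) edot (g s) (y s - u).
pose Q t : R := \sum_(s < t) (2 * (age big_demand s)%:R - 1).
pose Phi v z := potential (gamma * D) D v (edot (z - u) (z - u)).
have gD0 : 0 < gamma * D by rewrite mulr_gt0.
have S_ge0 m : 0 <= S m by apply: sumr_ge0 => j _; rewrite sqr_ge0.
have yhatE t : yhat t.+1 = eproj Y (yhat (tau (k t)) -
    adastep (gamma * D) (S (k t)) (H t) *: H t).
  by have [-> _] := step t; rewrite /adastep -sqr_enorm.
(* State at the start of round [t]. An open cycle of length [L] is charged [L^2]; as [L < age],
   extending it costs [2 L + 1 <= 2 age - 1], which is the increment of [Q]. *)
pose inv t := [/\ (tau (k t) <= t)%N, y t = yhat (tau (k t)),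
  (t - tau (k t) < age big_demand t)%N,
  S (k t) + G ^+ 2 * (t - tau (k t))%:R ^+ 2 <= G ^+ 2 * Q t &
  A t <= Phi (S (k t)) (y t) + edot (\sum_(tau (k t) <= s < t) g s) (y t - u)].
(* The accounts are settled at the candidate as if the cycle closed after round [t]. This serves
   real closures and also the horizon, where the last cycle may still be open. *)
have after_round t : inv t ->
    edot (H t) (H t) + S (k t) <= G ^+ 2 * Q t.+1 /\
    A t.+1 <= Phi (edot (H t) (H t) + S (k t)) (yhat t.+1).
  move=> [tau_le yE len SQ AP]; split.
    have := edot_sum_le (tau (k t)) (t - tau (k t)).+1 g_le.
    rewrite addnS subnKC// -/(H t).
    rewrite /Q big_ord_recr/= -/(Q t).
    move: len; rewrite -(ler_nat R) -natr1 => len.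
    have := ler_wpM2l (sqr_ge0 G) len; rewrite -natr1; lra.
  rewrite /A big_ord_recr/= -/(A t).
  have -> : Phi (edot (H t) (H t) + S (k t)) (yhat t.+1) =
      potential (gamma * D) D (edot (H t) (H t) + S (k t))
        (edot (yhat t.+1 - u) (yhat t.+1 - u)) by [].
  apply: le_trans (potential_step (z := y t) (h := H t) gD0 (S_ge0 _) _ _).
  - rewrite /H big_nat_recr// [X in _ <= _ + X]edotDl addrA lerD2r; exact: AP.
  - exact: edot_diam_le (maxcosd_in t) Yu.
  - by rewrite yhatE -yE; exact: edot_eproj_le D_ge0 Y_diam Yu.
have invP t : inv t.
  elim: t => [|t ih].
    split; rewrite ?k0 ?tau0 ?y0 ?yh0// ?subn0 ?age_gt0//.
      by rewrite /S /Q !big_ord0 expr0n !mulr0 addr0.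
    rewrite /A big_ord0 /Phi /S big_ord0 /potential sqrtr0 mul0r add0r.
    by rewrite big_geq// edot0l.
  have [SQ AP] := after_round t ih; have [tau_le yE len _ _] := ih.
  have [_] := step t; case: ifPn => [le [yt kt taut]|nle [yt kt]].
    rewrite /inv taut yt subnn age_gt0; split=> //.
    - by rewrite kt /S big_ord_recr/= -/(S _) -kt taut -/(H t) sqr_enorm expr0n
        mulr0 addr0 addrC.
    - by rewrite big_geq// edot0l addr0 kt /S big_ord_recr/= -/(S _) -kt taut
        -/(H t) sqr_enorm addrC.
  rewrite /inv kt yt; split => //.
  - exact: leqW.
  (* Only a large demand resets the age, and it would have closed the cycle; so the age grows along
     with the cycle. *)
  - rewrite subSn// ageS; case: ifPn => [bt|//]; case/negP: nle.
    by rewrite yhatE; apply: proj_step_closes => //; rewrite -yE; exact: maxcosd_in.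
  - rewrite subSn//; have [_ _ _ SQ' _] := ih.
    move: len; rewrite -(ler_nat R) -natr1 => len.
    have := ler_wpM2l (sqr_ge0 G) len.
    rewrite /Q big_ord_recr/= -/(Q t) -natr1; lra.
  - rewrite /A big_ord_recr/= -/(A t) big_nat_recr// [X in _ <= _ + X]edotDl addrA lerD2r.
    by have [_ _ _ _] := ih.
case: T => [|t]; first by rewrite big_ord0 !mulr_ge0 ?sqrtr_ge0 ?addr_ge0 ?invr_ge0//;
  rewrite ?mulr_ge0// ltW.
have [SQ /le_trans] := after_round t (invP t); apply.
rewrite /Phi /potential.
have Q0 : 0 <= Q t.+1.
  by rewrite -(pmulr_rge0 _ (exprn_gt0 2 G_gt0)) (le_trans _ SQ)// addr_ge0 ?edot_ge0.
have le1 : Num.sqrt (edot (H t) (H t) + S (k t)) <= G * Num.sqrt (Q t.+1).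
  rewrite (le_trans (ler_wsqrtr SQ))// sqrtrM ?sqr_ge0// sqrtr_sqr.
  by rewrite gtr0_norm.
(* Drop the final distance to [u]; [D > 0] permits cancelling one factor [D]. *)
have le2 : (D ^+ 2 - edot (yhat t.+1 - u) (yhat t.+1 - u)) / (2 * (gamma * D)) +
    gamma * D <= D * ((2 * gamma)^-1 + gamma).
  rewrite mulrDr (mulrC D gamma) lerD2r ler_pdivrMr ?mulr_gt0//.
  rewrite (_ : D / _ * _ = D ^+ 2) ?gerBl ?edot_ge0//.
  by field; rewrite gt_eqF.
have := edot_ge0 (yhat t.+1 - u); move=> e0.
apply: le_trans (ler_wpM2l (sqrtr_ge0 _) le2) _.
have c0 : 0 <= D * ((2 * gamma)^-1 + gamma).
  by rewrite mulr_ge0// addr_ge0 ?invr_ge0 ?mulr_ge0// ltW.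
apply: le_trans (ler_wpM2r c0 le1) _.
by rewrite le_eqVlt; apply/orP; left; apply/eqP; rewrite -/(Q t.+1); ring.
Qed.

Lemma maxcosd_regret (ell : nat -> 'rV[R]_n -> R) T :
  (forall t, subdiff (ell t) (y t) (g t)) ->
  regret Y ell y T <=
  G * D * ((2 * gamma)^-1 + gamma) *
    Num.sqrt (\sum_(s < T) (2 * (age big_demand s)%:R - 1)).
Proof.
move=> gsub; rewrite /regret lerBlDl -lerBlDr.
apply: lb_le_inf; first by exists (\sum_(t < T) ell t y1); exists y1.
move=> _ [u Yu <-]; rewrite lerBlDr -lerBlDl -sumrB.
apply: (@le_trans _ _ (\sum_(s < T) edot (g s) (y s - u))).
  apply: ler_sum => s _; have := gsub s u.
  by rewrite -[u - _]opprB edotNr; lra.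
(* The potential divides by [D]. If [D = 0], then [Y] is a single point and every linear term
   vanishes. *)
have [D0|D0] := ltP 0 D; first exact: maxcosd_linear_regret.
have D00 : D = 0 by apply/le_anti/andP.
rewrite D00 mulr0 !mul0r big1// => s _.
suff -> : y s - u = 0 by rewrite edotC edot0l.
apply: edot_eq0; apply/le_anti; rewrite edot_ge0 andbT.
by have := edot_diam_le D_ge0 Y_diam (maxcosd_in s) Yu; rewrite D00 expr0n.
Qed.

End maxcosd_run.

(** * Distribution of the age *)

Lemma measurable_forall (d : measure_display) (T : measurableType d)
  (I : finType) (p : I -> T -> bool) :
  (forall i, measurable [set w | p i w]) -> measurable [set w | [forall i, p i w]].
Proof.
move=> mp; rewrite (_ : [set w | _] = \bigcap_(i in [set: I]) [set w | p i w]).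
  exact: fin_bigcap_measurable.
by apply/seteqP; split => w /= => [/forallP h i _|h];
  [exact: h|apply/forallP => i; exact: h].
Qed.

Lemma measurable_quiet (d : measure_display) (T : measurableType d)
  (b : nat -> T -> bool) s t :
  (forall r, (r < t)%N -> measurable [set w | b r w]) ->
  measurable [set w | quiet (b^~ w) s t].
Proof.
move=> mb; apply: measurable_forall => r.
have [sr|sr] := leqP s r; last by rewrite /= (_ : [set _ | _] = setT)//; apply/seteqP.
rewrite (_ : [set _ | _] = ~` [set w | b r w]); first exact/measurableC/mb.
by apply/seteqP; split => w /= => [/negP//|/negP].
Qed.

(** The partial sums obey [a' = 1 + (1 - mu) a], whose fixed point is [mu^-1]. *)
Lemma sum_geometric_le (R : realType) (mu : R) t : 0 < mu -> mu <= 1 ->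
  \sum_(s < t.+1) (1 - mu) ^+ (t - s) <= mu^-1.
Proof.
move=> mu0 mu1; elim: t => [|t ih].
  by rewrite big_ord_recl big_ord0 addr0 expr0 invf_ge1.
rewrite big_ord_recr/= subnn expr0.
under eq_bigr => s _ do rewrite subSn -1?ltnS// exprS.
rewrite -mulr_sumr; have := ler_wpM2l (_ : 0 <= 1 - mu) ih.
rewrite subr_ge0 => /(_ mu1); rewrite [leRHS]mulrBl mul1r mulfV ?gt_eqF//; lra.
Qed.

Section quiet_probability.
Context {R : realType} {disp : measure_display} {Omega : measurableType disp}
  (P : probability Omega R).

Lemma cond_prob_ge (F : set (set Omega)) (E A : set Omega) (Z : Omega -> R)
    (mu : R) :
  is_cond_prob P F E Z -> 0 <= mu -> {ae P, forall w, mu <= Z w} ->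
  F A -> measurable A -> (mu%:E * P A <= P (E `&` A))%E.
Proof.
move=> [_ Zint Zint_eq] mu0 muZ FA mA; rewrite -Zint_eq//.
have mZ : measurable_fun A (fun w => (Z w)%:E).
  by apply: measurable_funTS; exact: (measurable_int _ Zint).
(* The bound [mu <= Z] holds only almost everywhere; replacing [Z] by its maximum with [mu] keeps
   the integral and makes the bound pointwise. *)
have mM : measurable_fun A (fun w => (Num.max mu (Z w))%:E).
  apply/measurable_EFinP; apply: measurable_maxr; first exact: measurable_cst.
  exact/measurable_EFinP.
rewrite (ae_eq_integral (fun w => (Num.max mu (Z w))%:E))//.
  rewrite -integral_cst//; apply: ge0_le_integral => //.
  by move=> w _ /=; rewrite lee_fin le_max lexx.
by apply: filterS muZ => w /max_idPr -> _.
Qed.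

Context (b : nat -> Omega -> bool) (F : nat -> set (set Omega)) (mu : R).
Context (mu_gt0 : 0 < mu) (mu_le1 : mu <= 1)
  (mb : forall t, measurable [set w | b t w])
  (F_quiet : forall s t, F t [set w | quiet (b^~ w) s t])
  (b_cond : forall t, exists2 Z : Omega -> R,
     is_cond_prob P (F t) [set w | b t w] Z & {ae P, forall w, mu <= Z w}).

Let mquiet s t : measurable [set w | quiet (b^~ w) s t].
Proof. exact: measurable_quiet. Qed.

(** A quiet block up to [t] is an event of [F t], so at least a fraction [mu] of its mass meets a
    large demand in round [t]. *)
Lemma prob_quiet s t : (s <= t)%N ->
  (P [set w | quiet (b^~ w) s t] <= ((1 - mu) ^+ (t - s))%:E)%E.
Proof.
move=> /subnK <-; elim: (t - s)%N => [|l ih].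
  by rewrite add0n subnn expr0 probability_le1.
rewrite addSn subSn ?leq_addl//; move: (l + s)%N (leq_addl l s) ih => {t} {}t st ih.
have -> : [set w | quiet (b^~ w) s t.+1] =
    [set w | quiet (b^~ w) s t] `\` [set w | b t w].
  apply/seteqP; split => w /=; rewrite quietS//; first by move=> /andP[? /negP].
  by move=> [? /negP ?]; apply/andP.
have -> : (P ([set w | quiet (b^~ w) s t] `\` [set w | b t w]) =
    P [set w | quiet (b^~ w) s t] -
    P ([set w | quiet (b^~ w) s t] `&` [set w | b t w]))%E.
  by rewrite measureD//; rewrite (le_lt_trans (probability_le1 _ _)) ?ltry.
have [Z cZ muZ] := b_cond t.
have := cond_prob_ge cZ (ltW mu_gt0) muZ (F_quiet s t) (mquiet s t).
rewrite setIC; move: ih.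
rewrite -(fineK (fin_num_measure P _ (mquiet s t))).
have mqb : measurable ([set w | quiet (b^~ w) s t] `&` [set w | b t w]).
  exact: measurableI.
rewrite -(fineK (fin_num_measure P _ mqb)) -EFinM -EFinB !lee_fin.
move: (fine _) (fine _) => p q ih pq; rewrite exprS.
have := ler_wpM2l (_ : 0 <= 1 - mu) ih; rewrite subr_ge0 => /(_ mu_le1); lra.
Qed.

Lemma expected_age_le t :
  (\sum_(s < t.+1) P [set w | quiet (b^~ w) s t] <= (mu^-1)%:E)%E.
Proof.
apply: (@le_trans _ _ (\sum_(s < t.+1) ((1 - mu) ^+ (t - s))%:E)%E).
  by apply: lee_sum => s _; rewrite prob_quiet// -ltnS.
by rewrite sumEFin lee_fin sum_geometric_le.
Qed.

(** The expectation is bounded by the integral of the positive part of [f], and the affine majorant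
    is a finite sum of indicators, integrated term by term. *)
Lemma expectation_age_le (f : Omega -> R) (K1 K2 : R) T :
  measurable_fun setT f -> 0 <= K1 -> 0 <= K2 ->
  (forall w, f w <= K1 + K2 * \sum_(t < T) (age (b^~ w) t)%:R) ->
  ('E_P[f] <= (K1 + K2 * (T%:R / mu))%:E)%E.
Proof.
move=> mf K10 K20 fle; rewrite unlock.
pose q s t w : R := \1_[set w | quiet (b^~ w) s t] w.
have mq s t : measurable_fun setT (q s t) by exact: measurable_indic.
have fle' w : (f w <= K1 + \sum_(t < T) \sum_(s < t.+1) K2 * q s t w).
  rewrite (le_trans (fle w))// lerD2l mulr_sumr ler_sum// => t _.
  rewrite /age natr_sum mulr_sumr le_eqVlt; apply/orP; left; apply/eqP.
  apply: eq_bigr => s _; rewrite /q indicE; congr (_ * (nat_of_bool _)%:R).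
  by apply/idP/idP => [qs|]; [rewrite inE|move/set_mem].
have F0 w : 0 <= \sum_(t < T) \sum_(s < t.+1) K2 * q s t w.
  by do 2![apply: sumr_ge0 => ? _]; rewrite mulr_ge0 ?/q ?indicE.
have mF : measurable_fun setT (fun w => \sum_(t < T) \sum_(s < t.+1) K2 * q s t w).
  by do 2![apply: measurable_sum => ?]; exact: measurable_funM.
rewrite integralE; apply: le_trans (geeDl _ _) _.
  by rewrite leeNl oppe0 integral_ge0.
apply: (@le_trans _ _ (\int[P]_w (K1 +
    \sum_(t < T) \sum_(s < t.+1) K2 * q s t w)%:E)%E).
  apply: ge0_le_integral => //.
  - by apply: measurable_funepos; exact/measurable_EFinP.
  - by apply/measurable_EFinP; exact: measurable_funD.
  - by move=> w _; rewrite funeposE ge_max !lee_fin fle' addr_ge0.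
under eq_integral do rewrite EFinD.
rewrite ge0_integralD//; [|by move=> w _; rewrite lee_fin|exact/measurable_EFinP].
rewrite integral_cst// [X in (_ * X)%E]probability_setT mule1 EFinD leeD2l//.
under eq_integral do rewrite -sumEFin.
rewrite ge0_integral_sum//; last 2 first.
- move=> t; apply/measurable_EFinP; apply: measurable_sum => s.
  exact: measurable_funM.
- by move=> t w _; rewrite lee_fin sumr_ge0// => s _; rewrite mulr_ge0 ?/q ?indicE.
have -> : K2 * (T%:R / mu) = \sum_(t < T) K2 * mu^-1.
  by rewrite sumr_const card_ord -mulr_natr; ring.
rewrite -sumEFin; apply: lee_sum => t _.
under eq_integral do rewrite -sumEFin.
rewrite ge0_integral_sum//; last 2 first.
- by move=> s; apply/measurable_EFinP; exact: measurable_funM.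
- by move=> s w _; rewrite lee_fin mulr_ge0 ?/q ?indicE.
rewrite EFinM; apply: le_trans (lee_wpmul2l _ (expected_age_le t)); last first.
  by rewrite lee_fin.
rewrite ge0_sume_distrr//; apply: lee_sum => s _.
under eq_integral do rewrite EFinM.
rewrite ge0_integralZl_EFin//; last 2 first.
- by move=> w _; rewrite lee_fin /q indicE.
- exact/measurable_EFinP.
by rewrite integral_indic// setIT.
Qed.

Lemma prob_age_le T j (E : set Omega) : measurable E ->
  (forall w, (forall t, (t < T)%N -> (age (b^~ w) t <= j)%N) -> E w) ->
  ((1 - T%:R * (1 - mu) ^+ j)%:E <= P E)%E.
Proof.
move=> mE ageE.
(* For [t < j] the age is at most [t + 1 <= j], so such rounds contribute nothing to the union
   bound. *)
pose A t := if (j <= t)%N then [set w | quiet (b^~ w) (t - j) t] else set0.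
have mA t : measurable (A t) by rewrite /A; case: ifP.
have AP t : (P (A t) <= ((1 - mu) ^+ j)%:E)%E.
  rewrite /A; case: ifPn => [jt|_]; last first.
    by rewrite measure0 lee_fin exprn_ge0 ?subr_ge0.
  by have := prob_quiet (leq_subr j t); rewrite subKn.
have sub : ~` E `<=` \big[setU/set0]_(t < T) A t.
  move=> w nE; apply: contrapT => nA; apply/nE/ageE => t tT.
  rewrite leqNgt; apply/negP => /age_gt/andP[jt q]; apply: nA.
  rewrite -bigcup_mkord; exists t => //=.
  by rewrite /A jt.
have mCE := measurableC mE.
have : (P (~` E) <= (T%:R * (1 - mu) ^+ j)%:E)%E.
  apply: le_trans (content_subadditive P (fun k _ => mA k) mCE sub) _.
  apply: (@le_trans _ _ (\sum_(t < T) ((1 - mu) ^+ j)%:E)%E).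
    by apply: lee_sum => t _; exact: AP.
  by rewrite sumEFin sumr_const card_ord mulr_natl.
rewrite probability_setC// -(fineK (fin_num_measure P _ mE)) -EFinB !lee_fin; lra.
Qed.

End quiet_probability.

(** From [1 - mu <= expR (- mu)]; [a] is real because it will be a logarithmic threshold. *)
Lemma tail_geometric_le (R : realType) (mu a : R) j : mu <= 1 -> 0 <= mu ->
  a <= j%:R -> (1 - mu) ^+ j <= expR (- (mu * a)).
Proof.
move=> mu1 mu0 aj; apply: (@le_trans _ _ (expR (- mu) ^+ j)).
  by apply: lerXn2r; rewrite ?nnegrE ?subr_ge0 ?expR_ge0// expR_ge1Dx.
by rewrite -expRM_natl ler_expR mulrN lerN2 [leRHS]mulrC ler_wpM2l.
Qed.

Lemma past_quiet (R : realType) (disp : measure_display)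
  (Omega : measurableType disp) n (ell : nat -> Omega -> 'rV[R]_n -> R)
  (d : nat -> Omega -> 'rV[R]_n) (rho : R) s t :
  past ell d t
    [set w | quiet (fun r => [forall i, rho <= d r w 0 i]) s t].
Proof.
(* Measurability is taken in the sigma-algebra of the past itself: only demands of rounds before [t]
   enter. *)
apply: (@measurable_quiet _ (g_sigma_algebraType _)
  (fun r w => [forall i, rho <= d r w 0 i])) => r rt.
apply: measurable_forall => i; apply: sub_sigma_algebra.
exists r => //; right; exists i => //; exists `[rho, +oo[%classic.
  exact: measurable_itv.
by apply/seteqP; split => w /=; rewrite in_itv/= andbT => // -[].
Qed.

(** * Feasibility, and regret in expectation and with high probability *)

Theorem theorem12 (R : realType) (disp : measure_display)
  (Omega : measurableType disp) (P : probability Omega R) (n : nat)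
  (Y : set 'rV[R]_n) (D G mu rho gamma : R) (y1 : 'rV[R]_n)
  (ell : nat -> Omega -> 'rV[R]_n -> R) (d : nat -> Omega -> 'rV[R]_n)
  (X : seq ('rV[R]_n * 'rV[R]_n) -> 'rV[R]_n)
  (Gamma : nat -> ('rV[R]_n -> R) -> 'rV[R]_n -> 'rV[R]_n)
  (x y g : nat -> Omega -> 'rV[R]_n)
  (* demands and losses *)
  (d_ge0 : forall t w, lev 0 (d t w))
  (d_meas : forall t i, measurable_fun setT (fun w => d t w 0 i))
  (ell_meas : forall t z, measurable_fun setT (fun w => ell t w z))
  (* (A) *)
  (Y_closed : closed Y)
  (Y_convex : @convex_set R 'rV[R]_n Y)
  (Y_ge0 : forall u, Y u -> lev 0 u)
  (D_ge0 : 0 <= D)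
  (Y_diam : (ediam Y <= D%:E)%E)
  (ell_convex : forall t w, @convex_function R 'rV[R]_n setT (ell t w))
  (G_gt0 : 0 < G)
  (subgrad_le : forall t w u v, Y u -> subdiff (ell t w) u v -> enorm v <= G)
  (* (B) *)
  (mu_gt0 : 0 < mu) (mu_le1 : mu <= 1) (rho_gt0 : 0 < rho)
  (d_cond : forall t, exists2 Z : Omega -> R,
     is_cond_prob P (past ell d t) [set w | forall i, rho <= d t w 0 i] Z &
     {ae P, forall w, mu <= Z w})
  (* (C) *)
  (X_rule : dynamics_rule Y X)
  (Gamma_rule : forall t w u, Y u ->
     subdiff (ell t w) u (Gamma t (ell t w) u))
  (x_def : forall w, follows_dynamics X (d^~ w) (x^~ w) (y^~ w))
  (g_def : forall t w, g t w = Gamma t (ell t w) (y t w))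
  (* the algorithm *)
  (y1_in : Y y1) (gamma_gt0 : 0 < gamma)
  (y_def : forall w, maxcosd Y D gamma y1 (g^~ w) (x^~ w) (y^~ w))
  (* the regret is a random variable *)
  (regret_meas : forall T,
     measurable_fun setT (fun w => regret Y (ell^~ w) (y^~ w) T)) :
  (forall t w, lev (x t w) (y t w)) /\
  ((0 < D -> gamma <= rho / D) ->
   forall T : nat, (0 < T)%N ->
     ('E_P[fun w => regret Y (ell^~ w) (y^~ w) T] <=
       (Num.sqrt 2 * G * D / mu * ((2 * gamma)^-1 + gamma + 1) *
        Num.sqrt T%:R)%:E)%E /\
     forall delta : R, 0 < delta -> delta < 1 ->
       ((1 - delta)%:E <=
        P [set w | (regret Y (ell^~ w) (y^~ w) T <=
          G * D * ((2 * gamma)^-1 + gamma + 1) *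
          (1 + mu^-1 * ln (T%:R / delta)) * Num.sqrt T%:R)%R])%E).
Proof.
have y_in t w : Y (y t w).
  exact: (maxcosd_in Y_closed D_ge0 Y_diam y1_in (y_def w) t).
have x0 w : x 0%N w = 0 by have [] := x_def w.
have x_le w t : lev (x t.+1 w) (posv (y t w - d t w)).
  have [_ ->] := x_def w; rewrite mkseqS; apply: X_rule => z.
  by rewrite -mkseqS => /mapP[s _ ->] /=; split; [exact: y_in|exact: d_ge0].
split=> [t w|gamma_le T T_gt0].
  exact: (maxcosd_feasible Y_closed Y_ge0 D_ge0 Y_diam y1_in (y_def w)
    (d_ge0^~ w) (x0 w) (x_le w) t).
have gammaD_le : gamma * D <= rho.
  have [D0|D0] := ltP 0 D; first by rewrite -ler_pdivlMr// gamma_le.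
  have -> : D = 0 by apply/le_anti/andP.
  by rewrite mulr0 ltW.
have g_sub w t : subdiff (ell t w) (y t w) (g t w).
  by rewrite g_def; exact/Gamma_rule/y_in.
have g_le w t : enorm (g t w) <= G by exact: subgrad_le (y_in t w) (g_sub w t).
pose b t w := [forall i, rho <= d t w 0 i].
pose C := G * D * ((2 * gamma)^-1 + gamma).
have reg_le w : regret Y (ell^~ w) (y^~ w) T <=
    C * Num.sqrt (\sum_(s < T) (2 * (age (b^~ w) s)%:R - 1)).
  exact: (maxcosd_regret Y_closed Y_convex Y_ge0 D_ge0 Y_diam y1_in gamma_gt0
    (y_def w) (x_le w) G_gt0 (g_le w) gammaD_le T (g_sub w)).
have C_ge0 : 0 <= C.
  by rewrite !mulr_ge0 ?addr_ge0 ?invr_ge0 ?mulr_ge0// ltW.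
have CleC : C <= G * D * ((2 * gamma)^-1 + gamma + 1).
  by rewrite ler_wpM2l ?lerDl// mulr_ge0// ltW.
have mb t : measurable [set w | b t w].
  apply: measurable_forall => i; rewrite (_ : [set _ | _] =
    setT `&` (fun w => d t w 0 i) @^-1` `[rho, +oo[); first exact: d_meas.
  by apply/seteqP; split => w /=; rewrite in_itv/= andbT => // -[].
have Fq s t : past ell d t [set w | quiet (b^~ w) s t] by exact: past_quiet.
have b_cond t : exists2 Z : Omega -> R,
    is_cond_prob P (past ell d t) [set w | b t w] Z & {ae P, forall w, mu <= Z w}.
  rewrite (_ : [set w | b t w] = [set w | forall i, rho <= d t w 0 i])//.
  by apply/seteqP; split => w /forallP.
have T0 : 0 < T%:R :> R by rewrite ltr0n.
have age1 w s : 1 <= (age (b^~ w) s)%:R :> R by rewrite ler1n age_gt0.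
split=> [|delta delta0 delta1].
  (* [c ^+ 2] bounds the expectation of the sum under the root. With this weight the affine AM-GM
     bound integrates to exactly [C * c], as Jensen's inequality would give. *)
  pose c := Num.sqrt (2 * (T%:R / mu)).
  have c0 : 0 < c by rewrite sqrtr_gt0 mulr_gt0// divr_gt0.
  have c2 : c ^+ 2 = 2 * (T%:R / mu) by rewrite sqr_sqrtr// mulr_ge0// divr_ge0 ?ltW.
  have K10 : 0 <= C * c / 2 by rewrite divr_ge0// mulr_ge0// ltW.
  have K20 : 0 <= C / c by rewrite divr_ge0// ltW.
  have regF w : regret Y (ell^~ w) (y^~ w) T <=
      C * c / 2 + C / c * \sum_(t < T) (age (b^~ w) t)%:R.
    apply: (le_trans (reg_le w)); set Q := \sum_(s < T) (_ - _).
    have Q0 : 0 <= Q.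
      by apply: sumr_ge0 => s _; have := age1 w s; lra.
    have Qle : Q <= 2 * \sum_(s < T) (age (b^~ w) s)%:R.
      by rewrite mulr_sumr ler_sum// => s _; rewrite gerBl.
    (* AM-GM: [2 c sqrt Q <= c^2 + Q] *)
    have amgm : Num.sqrt Q <= c / 2 + Q / (2 * c).
      have -> : c / 2 + Q / (2 * c) = (c ^+ 2 + Q) / (2 * c).
        by field; rewrite gt_eqF.
      rewrite ler_pdivlMr ?mulr_gt0// -[in leRHS](sqr_sqrtr Q0).
      by have := sqr_ge0 (Num.sqrt Q - c); rewrite sqrrB; lra.
    apply: le_trans (ler_wpM2l C_ge0 amgm) _.
    have -> : C * (c / 2 + Q / (2 * c)) = C * c / 2 + C / c * (Q / 2).
      by field; rewrite gt_eqF.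
    by rewrite lerD2l ler_wpM2l//; lra.
  apply: le_trans (expectation_age_le mu_gt0 mu_le1 mb (F := past ell d) Fq b_cond
    (regret_meas T) K10 K20 regF) _.
  rewrite lee_fin.
  have -> : C * c / 2 + C / c * (T%:R / mu) = C * c.
    have -> : T%:R / mu = c ^+ 2 / 2 by rewrite c2; field; rewrite gt_eqF.
    by field; rewrite gt_eqF.
  (* The root of [mu^-1] is at most [mu^-1] since [mu <= 1]. *)
  have cle : c <= Num.sqrt 2 * Num.sqrt T%:R / mu.
    have mu1 : 1 <= mu^-1 by rewrite invf_ge1.
    rewrite /c mulrA sqrtrM ?mulr_ge0// sqrtrM// ler_wpM2l ?mulr_ge0 ?sqrtr_ge0//.
    apply: (@le_trans _ _ (Num.sqrt (mu^-1 ^+ 2))).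
      by rewrite ler_wsqrtr// expr2 ler_peMl// invr_ge0 ltW.
    by rewrite sqrtr_sqr ger0_norm// invr_ge0 ltW.
  apply: le_trans (ler_wpM2l C_ge0 cle) _.
  have m0 : 0 <= Num.sqrt 2 * Num.sqrt T%:R / mu.
    by rewrite divr_ge0 ?mulr_ge0 ?sqrtr_ge0// ltW.
  apply: le_trans (ler_wpM2r m0 CleC) _.
  by rewrite le_eqVlt; apply/orP; left; apply/eqP; ring.
pose a := mu^-1 * ln (T%:R / delta).
have Td : 1 <= T%:R / delta.
  by rewrite ler_pdivlMr// mul1r (le_trans (ltW delta1))// ler1n.
have a0 : 0 <= a by rewrite mulr_ge0 ?invr_ge0 ?ln_ge0// ltW.
(* This integer satisfies [a < j <= 1 + a]: the lower bound makes the union bound at most [delta],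
   the upper one gives the stated factor. *)
pose j := Num.truncn (1 + a).
have /andP[ja aj] := truncn_itv (addr_ge0 ler01 a0).
rewrite -/j -natr1 in ja aj.
have tail : T%:R * (1 - mu) ^+ j <= delta.
  have aj' : a <= j%:R by lra.
  apply: le_trans (ler_wpM2l (ltW T0) (tail_geometric_le mu_le1 (ltW mu_gt0) aj')) _.
  rewrite /a mulrA mulfV ?gt_eqF// mul1r expRN lnK ?posrE ?divr_gt0//.
  by rewrite invf_div mulrC divfK// gt_eqF.
set E := [set w | _].
have mE : measurable E.
  rewrite (_ : E = setT `&` (fun w => regret Y (ell^~ w) (y^~ w) T) @^-1`
    `]-oo, G * D * ((2 * gamma)^-1 + gamma + 1) * (1 + a) * Num.sqrt T%:R]).
    exact: regret_meas.
  by apply/seteqP; split => w /=; rewrite in_itv/= => // -[].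
apply: le_trans (prob_age_le mu_gt0 mu_le1 mb (F := past ell d) Fq b_cond
  (T := T) (j := j) mE _).
  by rewrite lee_fin; lra.
move=> w age_le; rewrite /E/= -/a; apply: (le_trans (reg_le w)).
have j1 : 1 <= j%:R :> R.
  by have := age_le 0%N T_gt0; rewrite age0 ler1n.
have Qle : Num.sqrt (\sum_(s < T) (2 * (age (b^~ w) s)%:R - 1)) <=
    (1 + a) * Num.sqrt T%:R.
  apply: (@le_trans _ _ (j%:R * Num.sqrt T%:R)); last by rewrite ler_wpM2r ?sqrtr_ge0.
  rewrite -[X in X * _]ger0_norm// -sqrtr_sqr -sqrtrM ?sqr_ge0// ler_wsqrtr//.
  (* Each term is at most [2 j - 1 <= j^2], so the root is at most [j] times the root of [T]. *)
  apply: (@le_trans _ _ (\sum_(s < T) j%:R ^+ 2)).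
    apply: ler_sum => s _; have := age_le s (ltn_ord s).
    by rewrite -(ler_nat R); have := sqr_ge0 (j%:R - 1 : R); rewrite sqrrB1; lra.
  by rewrite sumr_const card_ord mulr_natr.
apply: le_trans (ler_wpM2l C_ge0 Qle) _; rewrite -mulrA ler_wpM2r//.
by rewrite mulr_ge0 ?sqrtr_ge0 ?addr_ge0.
Qed.
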